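(* Let $\omega=e^{\pi i/3}$ and $\Gamma=\langle A,B\rangle\subset\mathrm{PSL}_2(\mathbb{Z}[\omega])$ with $A=\begin{pmatrix}1&1\\0&1\end{pmatrix}$, $B=\begin{pmatrix}1&0\\ 1+\omega&1\end{pmatrix}$. If $X,Y\in\Gamma$ satisfy $\Gamma=\langle X,Y\rangle$ and $\mathrm{tr}\,X=\mathrm{tr}\,Y$, then $X$ and $Y$ are parabolic.
   Context: $\Gamma$ is the image of the discrete faithful representation of the fundamental group of the complement of the two-component two-bridge link $6^2_2$ in $S^3$, so $\mathbb{H}^3/\Gamma\cong S^3\smallsetminus 6^2_2$; it is a finite-covolume Kleinian group with traces in $\mathbb{Z}[\omega]$, the ring of integers of its trace field $\mathbb{Q}(\omega)$. Traces are taken of lifts to $\mathrm{SL}_2\mathbb{C}$; ''$\mathrm{tr}\,X=\mathrm{tr}\,Y$'' means the elements admit lifts of equal trace. Parabolic means non-identity with $\mathrm{tr}^2=4$. *)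

(* Defs.v *)
From HB Require Import structures.
From mathcomp Require Import all_boot all_order all_algebra all_field.
Set Implicit Arguments. Unset Strict Implicit. Unset Printing Implicit Defensive.
Import Order.TTheory GRing.Theory Num.Theory.
Local Open Scope ring_scope.

Definition mx2 (a b c d : algC) : 'M[algC]_2 :=
  \matrix_(i < 2, j < 2)
    (if (i : nat) == 0%N then (if (j : nat) == 0%N then a else b)
     else (if (j : nat) == 0%N then c else d)).

(* omega = e^{pi i/3} = (1 + i sqrt 3)/2 *)
Definition omega : algC := (1 + 'i * sqrtC 3) / 2.

Definition matA : 'M[algC]_2 := mx2 1 1 0 1.
Definition matB : 'M[algC]_2 := mx2 1 0 (1 + omega) 1.

Inductive gen_grp (S : 'M[algC]_2 -> Prop) : 'M[algC]_2 -> Prop :=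
  | gen_in x : S x -> gen_grp S x
  | gen_one : gen_grp S 1%:M
  | gen_mul x y : gen_grp S x -> gen_grp S y -> gen_grp S (x *m y)
  | gen_inv x : gen_grp S x -> gen_grp S (invmx x).

(* Preimage in SL_2 of the subgroup <X, Y> of PSL_2 generated by the images of X, Y. *)
Definition lift_gen2 (X Y : 'M[algC]_2) : 'M[algC]_2 -> Prop :=
  gen_grp (fun M => M = X \/ M = Y \/ M = - 1%:M).

Definition GammaLift : 'M[algC]_2 -> Prop := lift_gen2 matA matB.

(* Parabolic (for an SL_2 lift X): non-identity in PSL_2 and tr^2 = 4. *)
Definition parabolic (X : 'M[algC]_2) : Prop :=
  X <> 1%:M /\ X <> - 1%:M /\ (\tr X) ^+ 2 = 4.

(* Main.v *)
(* Put pi_ = 1 + omega, of norm 3, and let x = tr X = tr Y, z = tr XY.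
   Since A and B lie in the Z[omega]-span of 1, X, Y, XY, the number
   det (AB - BA) = - pi_^2 is a multiple of det (XY - YX) in Z[omega]; and
   conversely, as X and Y lie in the order Z[omega]<A, B>.  By Fricke's identity
   det (XY - YX) = - (z - 2) (z + 2 - x^2), so (z - 2) (z + 2 - x^2) is a unit
   times pi_^2.  Modulo 2 the group is dihedral of order 10, and X, Y cannot
   both be rotations since they do not commute modulo 2, so x = 2 y with y in
   Z[omega]; and x is nonzero because Gamma is triangular modulo pi_.  The norm
   equation leaves finitely many pairs (z, y), and all of them have
   y = 0 or y^2 = 1. *)
Require Import Defs.
From HB Require Import structures.
From mathcomp Require Import all_boot all_order all_algebra all_field.
From mathcomp Require Import ring lra zify.
Import Order.TTheory GRing.Theory Num.Theory.
Local Open Scope ring_scope.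

(** * Arithmetic and norms in Z[omega] *)

Lemma omega_sqr : omega ^+ 2 = omega - 1.
Proof.
have i2 : 'i ^+ 2 = -1 :> algC by exact: sqrCi.
have s3 : sqrtC 3 ^+ 2 = 3 :> algC by exact: sqrtCK.
rewrite /omega expr_div_n sqrrD exprMn i2 s3; by field.
Qed.

Lemma omega_conj : omega^* = 1 - omega.
Proof.
have r3 : (sqrtC 3 : algC)^* = sqrtC 3.
  by apply: CrealP; apply: ger0_real; rewrite sqrtC_ge0 ler0n.
rewrite /omega rmorphM fmorphV rmorphD rmorphM rmorph1 /= conjCi r3 conjC_nat.
by field.
Qed.

Definition eis (u : algC) : Prop :=
  exists m n : int, u = m%:~R + n%:~R * omega.

(** The norm of m + n omega; the cross term is + m n because [omega] has trace 1. *)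
Definition nform (m n : int) : int := m ^+ 2 + m * n + n ^+ 2.

Lemma nform_ge0 m n : 0 <= nform m n.
Proof. rewrite /nform; nia. Qed.

Lemma eis_int (m : int) : eis m%:~R.
Proof. by exists m, 0; rewrite mul0r addr0. Qed.

Lemma eis_nat (n : nat) : eis n%:R.
Proof. exact: (eis_int n%:Z). Qed.

Lemma eis_omega : eis omega.
Proof. by exists 0, 1; rewrite mul1r add0r. Qed.

Lemma eisD u v : eis u -> eis v -> eis (u + v).
Proof.
move=> [m [n ->]] [m' [n' ->]]; exists (m + m'), (n + n').
by rewrite !rmorphD /=; ring.
Qed.

Lemma eisN u : eis u -> eis (- u).
Proof. by move=> [m [n ->]]; exists (- m), (- n); rewrite !rmorphN /=; ring. Qed.

Lemma eisM u v : eis u -> eis v -> eis (u * v).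
Proof.
move=> [m [n ->]] [m' [n' ->]].
exists (m * m' - n * n'), (m * n' + n * m' + n * n').
rewrite !(rmorphD, rmorphM, rmorphB) /=.
(* [omega] is an atom for [ring], so the difference of the two sides is exhibited as a multiple of
   its minimal polynomial. *)
apply: (@subr0_eq _ _ _).
transitivity (n%:~R * n'%:~R * (omega ^+ 2 - (omega - 1))); first by ring.
by rewrite omega_sqr subrr mulr0.
Qed.

Lemma eisX u n : eis u -> eis (u ^+ n).
Proof.
by move=> hu; elim: n => [|n IH]; [exact: (eis_nat 1) | rewrite exprS; exact: eisM].
Qed.

Lemma eis_sqr_norm (m n : int) :
  `|m%:~R + n%:~R * omega| ^+ 2 = (nform m n)%:~R :> algC.
Proof.
rewrite normCK rmorphD rmorphM !rmorph_int /= omega_conj /nform.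
rewrite !(rmorphD, rmorphM, rmorphXn) /=.
apply: (@subr0_eq _ _ _).
transitivity (- n%:~R ^+ 2 * (omega ^+ 2 - (omega - 1))); first by ring.
by rewrite omega_sqr subrr mulr0.
Qed.

Lemma eis_norm u : eis u -> exists2 k : int, 0 <= k & `|u| ^+ 2 = k%:~R.
Proof.
by move=> [m [n ->]]; exists (nform m n); [exact: nform_ge0 | exact: eis_sqr_norm].
Qed.

Ltac eis_tac := repeat first
  [ assumption | exact: eis_omega | apply: eisD | apply: eisN
  | apply: eisM | apply: eisX | exact: eis_nat | exact: (eis_nat 1)
  | exact: (eis_nat 0) ].

(** The two norms are non-negative integers with product 1. *)
Lemma eis_unit_norm u v : eis u -> eis v -> u * v = 1 -> `|u| ^+ 2 = 1.
Proof.
move=> /eis_norm[k k0 ku] /eis_norm[l l0 lv] uv.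
have : (k * l)%:~R = 1%:~R :> algC by rewrite rmorphM /= -ku -lv -exprMn -normrM uv normr1 expr1n.
move/intr_inj => kl; rewrite ku; suff -> : k = 1 by [].
have k1 : 1 <= k by nia.
have l1 : 1 <= l by nia.
nia.
Qed.

Lemma two_not_unit u : eis u -> 2 * u <> 1.
Proof.
move=> hu h; have := @eis_unit_norm 2 u (eis_nat 2) hu h.
by rewrite normr_nat -natrX => /eqP; rewrite pnatr_eq1.
Qed.

Notation pi_ := (1 + omega).

Lemma norm_pi : `|pi_| ^+ 2 = 3.
Proof. by have := eis_sqr_norm 1 1; rewrite mul1r. Qed.

Lemma pi_neq0 : pi_ != 0.
Proof. by rewrite -normr_eq0 -sqrf_eq0 norm_pi pnatr_eq0. Qed.

(** Norms again: 3 does not divide 16. *)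
Lemma pi_ndvd4 u : eis u -> pi_ * u <> 4.
Proof.
move=> /eis_norm[k k0 ku] h.
have : (3 * k)%:~R = 16%:~R :> algC.
  by rewrite rmorphM /= -ku -[3%:~R]norm_pi -exprMn -normrM h normr_nat -natrX.
by move/intr_inj; lia.
Qed.

(** * The norm equation and its finite search *)

Definition box (n : nat) : seq int := [seq (i%:Z - n%:Z) | i <- iota 0 n.*2.+1].

Lemma mem_box n (m : int) : - n%:Z <= m -> m <= n%:Z -> m \in box n.
Proof.
move=> h1 h2; apply/mapP; exists (`|(m + n%:Z)%R|%N); last by lia.
by rewrite mem_iota; lia.
Qed.

Lemma int_sqr_lt (c m : int) : 0 <= c -> m ^+ 2 < c ^+ 2 -> - c < m < c.
Proof. by move=> c0; rewrite -ltr_norml -[m ^+ 2]real_normK ?num_real // ltr_pXn2r ?nnegrE. Qed.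

(** Completing the square: 4 N = 3 m^2 + (m + 2 n)^2 = 3 n^2 + (2 m + n)^2. *)
Lemma nform_bound (c k m n : int) : 0 <= c -> 4 * k < 3 * c ^+ 2 ->
  nform m n <= k -> - c < m < c /\ - c < n < c.
Proof.
move=> c0 kc h; have := (sqr_ge0 (m + 2 * n), sqr_ge0 (2 * m + n)).
by move: h; rewrite /nform => h [s1 s2]; split; apply: int_sqr_lt => //; lra.
Qed.

(** The arguments on the left are the coordinates of (m + n omega)^2. *)
Lemma nform_sqr (m n : int) :
  nform (m ^+ 2 - n ^+ 2) (2 * m * n + n ^+ 2) = nform m n ^+ 2.
Proof. by rewrite /nform; ring. Qed.

Lemma nform_le7 (p q : int) : -2 <= p <= 2 -> -1 <= q <= 1 -> nform p q <= 7.
Proof.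
move=> hp hq.
have E : all (fun p => all (fun q => nform p q <= 7) (box 1)) (box 2).
  by vm_compute.
have i : p \in box 2 by apply: mem_box; lia.
have j : q \in box 1 by apply: mem_box; lia.
by move/allP: E => /(_ _ i)/allP/(_ _ j).
Qed.

(** The factors are the norms of a = a1 + a2 omega and of b = a + 4 - 4 y^2, where y = y1 + y2
    omega. Both are at most 9, which bounds a and b, hence their difference, hence y. *)
Lemma norm_equation_box (a1 a2 y1 y2 : int) :
  nform a1 a2 * nform (a1 + 4 - 4 * (y1 ^+ 2 - y2 ^+ 2))
                    (a2 - 4 * (2 * y1 * y2 + y2 ^+ 2)) = 9 ->
  [/\ -3 <= a1 <= 3, -3 <= a2 <= 3, -1 <= y1 <= 1 & -1 <= y2 <= 1].
Proof.
set p := y1 ^+ 2 - y2 ^+ 2; set q := 2 * y1 * y2 + y2 ^+ 2 => H.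
have Ny : nform p q = nform y1 y2 ^+ 2 by exact: nform_sqr.
move: (nform_ge0 a1 a2) (nform_ge0 (a1 + 4 - 4 * p) (a2 - 4 * q)) => a0 b0.
have [ha hb] : nform a1 a2 <= 9 /\ nform (a1 + 4 - 4 * p) (a2 - 4 * q) <= 9.
  move: H a0 b0; clear; move: (nform a1 a2) (nform (_ - _) _) => s t st s0 t0.
  have s1 : s != 0 by apply/eqP => e; rewrite e mul0r in st.
  have t1 : t != 0 by apply/eqP => e; rewrite e mulr0 in st.
  have t2 : 1 <= t by lia.
  have : 0 <= (s - 1) * t by apply: mulr_ge0; lia.
  have : 0 <= s * (t - 1) by apply: mulr_ge0; lia.
  by rewrite mulrBl mulrBr mul1r mulr1 st; lia.
have [sa1 sa2] := @nform_bound 4 9 _ _ isT isT ha.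
have [sb1 sb2] := @nform_bound 4 9 _ _ isT isT hb.
(* Here [p] and [q] are the coordinates of y^2. The bounds on a and b put 4 (p - 1) and 4 q in
   [-6, 6], so N(y)^2 <= 7 < 9. *)
have hy : nform y1 y2 <= 2.
  have : nform p q <= 7 by apply: nform_le7; clearbody p q; clear -sa1 sa2 sb1 sb2; lia.
  rewrite Ny; move: (nform_ge0 y1 y2); clear; move: (nform y1 y2) => N; nia.
have [sy1 sy2] := @nform_bound 2 2 _ _ isT isT hy.
clear -sa1 sa2 sy1 sy2; split; lia.
Qed.

(** Exhaustion over the 7 * 7 * 3 * 3 points of the box; the survivors have y = 0 or y = 1 or y =
    -1. *)
Lemma norm_equation (a1 a2 y1 y2 : int) :
  nform a1 a2 * nform (a1 + 4 - 4 * (y1 ^+ 2 - y2 ^+ 2))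
                    (a2 - 4 * (2 * y1 * y2 + y2 ^+ 2)) = 9 ->
  (y1 == 0) && (y2 == 0) || (y1 ^+ 2 == 1) && (y2 == 0).
Proof.
move=> H; have [sa1 sa2 sy1 sy2] := norm_equation_box _ _ _ _ H.
have E : all (fun a1 => all (fun a2 => all (fun y1 => all (fun y2 =>
    (nform a1 a2 * nform (a1 + 4 - 4 * (y1 ^+ 2 - y2 ^+ 2))
                    (a2 - 4 * (2 * y1 * y2 + y2 ^+ 2)) == 9) ==>
    ((y1 == 0) && (y2 == 0) || (y1 ^+ 2 == 1) && (y2 == 0)))
    (box 1)) (box 1)) (box 3)) (box 3) by vm_compute.
move/eqP: H; apply/implyP.
have [i1 i2] : a1 \in box 3 /\ a2 \in box 3 by split; apply: mem_box; lia.
have [j1 j2] : y1 \in box 1 /\ y2 \in box 1 by split; apply: mem_box; lia.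
by move/allP: E => /(_ _ i1)/allP/(_ _ i2)/allP/(_ _ j1)/allP/(_ _ j2).
Qed.

(* With a = tr XY - 2 and 2 y = tr X = tr Y, the product a (a + 4 - (2 y)^2)
   is - det (XY - YX). *)
Lemma trace_equation (a y v : algC) : eis a -> eis y -> `|v| ^+ 2 = 1 ->
  a * (a + 4 - (2 * y) ^+ 2) = pi_ ^+ 2 * v -> y <> 0 -> (2 * y) ^+ 2 = 4.
Proof.
move=> [a1 [a2 ea]] [y1 [y2 ey]] hv h y0.
have eb : a + 4 - (2 * y) ^+ 2 =
    (a1 + 4 - 4 * (y1 ^+ 2 - y2 ^+ 2))%:~R + (a2 - 4 * (2 * y1 * y2 + y2 ^+ 2))%:~R * omega.
  rewrite ea ey !(rmorphD, rmorphM, rmorphXn, rmorphN) /=.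
  apply: (@subr0_eq _ _ _).
  transitivity (- 4 * y2%:~R ^+ 2 * (omega ^+ 2 - (omega - 1))); first by ring.
  by rewrite omega_sqr subrr mulr0.
(* Norms of both sides: pi_^2 has norm 9 and v has norm 1. *)
have : (nform a1 a2 * nform (a1 + 4 - 4 * (y1 ^+ 2 - y2 ^+ 2))
                    (a2 - 4 * (2 * y1 * y2 + y2 ^+ 2)))%:~R = 9%:~R :> algC.
  rewrite rmorphM /= -!eis_sqr_norm -ea -eb -exprMn -normrM h normrM normrX exprMn hv mulr1.
  by rewrite norm_pi -natrX.
move/intr_inj/norm_equation => /orP[] /andP[/eqP e1 /eqP e2].
  by case: y0; rewrite ey e1 e2 mul0r addr0.
move/(congr1 (fun k : int => k%:~R : algC)): e1; rewrite rmorphXn /= => e1.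
by rewrite ey e2 mul0r addr0 exprMn e1; ring.
Qed.

(** * Explicit 2 by 2 matrices *)

Lemma mx2_mul a b c d a' b' c' d' :
  mx2 a b c d *m mx2 a' b' c' d' =
  mx2 (a * a' + b * c') (a * b' + b * d') (c * a' + d * c') (c * b' + d * d').
Proof.
apply/matrixP => i j; rewrite !mxE !big_ord_recl big_ord0 !mxE /= addr0.
by case: (nat_of_ord i == 0%N); case: (nat_of_ord j == 0%N).
Qed.

Lemma mx2_1 : 1%:M = mx2 1 0 0 1.
Proof.
by apply/matrixP => i j; rewrite !mxE; case: i j => [[|[|?]] ?] [[|[|?]] ?].
Qed.

Lemma mx2_opp a b c d : - mx2 a b c d = mx2 (- a) (- b) (- c) (- d).
Proof.
apply/matrixP => i j; rewrite !mxE.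
by case: (nat_of_ord i == 0%N); case: (nat_of_ord j == 0%N).
Qed.

Lemma mx2_tr a b c d : \tr (mx2 a b c d) = a + d.
Proof. by rewrite /mxtrace !big_ord_recl big_ord0 !mxE /= addr0. Qed.

Lemma mx2_inv a b c d : a * d - b * c = 1 ->
  invmx (mx2 a b c d) = mx2 d (- b) (- c) a.
Proof.
move=> h; have e : mx2 a b c d *m mx2 d (- b) (- c) a = 1%:M.
  rewrite mx2_mul mx2_1; congr mx2; rewrite -?h; ring.
have [u _] := mulmx1_unit e.
by rewrite -[RHS](mulKmx u) e mulmx1.
Qed.

(** * Gamma modulo 2 and modulo [pi_] *)

Definition even_eis (u : algC) : Prop := exists2 k, eis k & u = 2 * k.

Lemma even_eisD u v : even_eis u -> even_eis v -> even_eis (u + v).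
Proof. by move=> [k hk ->] [l hl ->]; exists (k + l); [eis_tac | ring]. Qed.

Lemma even_eisN u : even_eis u -> even_eis (- u).
Proof. by move=> [k hk ->]; exists (- k); [eis_tac | ring]. Qed.

Lemma even_eisM u v : eis u -> even_eis v -> even_eis (u * v).
Proof. by move=> hu [k hk ->]; exists (u * k); [eis_tac | ring]. Qed.

Lemma even_eis2 : even_eis 2.
Proof. by exists 1; [eis_tac | rewrite mulr1]. Qed.

Lemma even_eis0 : even_eis 0.
Proof. by exists 0; [eis_tac | rewrite mulr0]. Qed.

Ltac even_tac := repeat first
  [ assumption | exact: even_eis2 | exact: even_eis0 | apply: even_eisD
  | apply: even_eisN | apply: even_eisM; first by eis_tac ].

(* Modulo 2 the group Gamma is dihedral of order 10: in the coordinates of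
   [gamma_mx] the left disjunct holds for the rotations (the span of 1 and AB)
   and the right one for the reflections, which have even trace. *)
Definition dihedral2 (d t b c : algC) : Prop :=
  (even_eis (t - b) /\ even_eis (c - b)) \/
  (even_eis t /\ even_eis (d - b - c)).

(* Coordinates on the order Z[omega]<A, B>; the pair (d + pi_ t, d) encodes
   that the diagonal entries are congruent modulo pi_. *)
Definition gamma_mx (d t b c : algC) := mx2 (d + pi_ * t) b (pi_ * c) d.

Definition gamma_spec (M : 'M[algC]_2) : Prop :=
  exists d t b c : algC, [/\ M = gamma_mx d t b c,
    [/\ eis d, eis t, eis b & eis c],
    (d + pi_ * t) * d - b * (pi_ * c) = 1 & dihedral2 d t b c].

(** Multiplication in the dihedral group: the product is a rotation exactly when the factors are of
    the same kind. Each required quantity is written as a combination of the assumed even ones and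
    of 2. *)
Lemma dihedral2M d t b c d' t' b' c' :
  eis d -> eis t -> eis b -> eis c -> eis d' -> eis t' -> eis b' -> eis c' ->
  dihedral2 d t b c -> dihedral2 d' t' b' c' ->
  dihedral2 (pi_ * c * b' + d * d')
    (d * t' + t * d' + pi_ * t * t' + b * c' - c * b')
    ((d + pi_ * t) * b' + b * d') (c * (d' + pi_ * t') + d * c').
Proof.
move=> hd ht hb hc hd' ht' hb' hc' [] [h1 h2] [] [h1' h2'];
  [left | right | right | left]; split.
- suff -> : d * t' + t * d' + pi_ * t * t' + b * c' - c * b'
      - ((d + pi_ * t) * b' + b * d')
    = (d + pi_ * t) * (t' - b') + d' * (t - b) + b * (c' - b') - b' * (c - b)
    by even_tac.
  by ring.
- suff -> : c * (d' + pi_ * t') + d * c' - ((d + pi_ * t) * b' + b * d')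
    = d' * (c - b) + d * (c' - b') + pi_ * c * (t' - b') + pi_ * b' * (c - b)
      - pi_ * b' * (t - b) by even_tac.
  by ring.
- suff -> : d * t' + t * d' + pi_ * t * t' + b * c' - c * b'
    = (d + pi_ * t) * t' + t * (d' - b' - c') + (b' + c') * (t - b)
      - b' * (c - b) + b * c' * 2 by even_tac.
  by ring.
- suff -> : pi_ * c * b' + d * d' - ((d + pi_ * t) * b' + b * d')
      - (c * (d' + pi_ * t') + d * c')
    = d * (d' - b' - c') + (pi_ * b' - d') * (c - b) - pi_ * b' * (t - b)
      - b * d' * 2 - pi_ * c * t' by even_tac.
  by ring.
- suff -> : d * t' + t * d' + pi_ * t * t' + b * c' - c * b'
    = t' * (d - b - c) + (b + c) * (t' - b') + b * (c' - b') + b * b' * 2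
      + (d' + pi_ * t') * t by even_tac.
  by ring.
- suff -> : pi_ * c * b' + d * d' - ((d + pi_ * t) * b' + b * d')
      - (c * (d' + pi_ * t') + d * c')
    = d' * (d - b - c) - pi_ * c * (t' - b') - pi_ * b' * t - d * (c' - b')
      - d * b' * 2 by even_tac.
  by ring.
- suff -> : d * t' + t * d' + pi_ * t * t' + b * c' - c * b'
      - ((d + pi_ * t) * b' + b * d')
    = d * t' + (d' + pi_ * t' - pi_ * b') * t - b' * (d - b - c)
      - b * (d' - b' - c') - (b + c) * b' * 2 by even_tac.
  by ring.
- suff -> : c * (d' + pi_ * t') + d * c' - ((d + pi_ * t) * b' + b * d')
    = pi_ * c * t' - pi_ * b' * t + (c - b) * (d' - b' - c')
      + (c' - b') * (d - b - c) + (c * c' - b * b') * 2 by even_tac.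
  by ring.
Qed.

Lemma gamma_mxM d t b c d' t' b' c' :
  gamma_mx d t b c *m gamma_mx d' t' b' c' =
  gamma_mx (pi_ * c * b' + d * d')
    (d * t' + t * d' + pi_ * t * t' + b * c' - c * b')
    ((d + pi_ * t) * b' + b * d') (c * (d' + pi_ * t') + d * c').
Proof. by rewrite mx2_mul; congr mx2; ring. Qed.

Lemma GammaLift_spec M : GammaLift M -> gamma_spec M.
Proof.
elim=> {M} [M [->|[->|->]]||M N _ [d [t [b [c [-> [hd ht hb hc] h1 h2]]]]]
   _ [d' [t' [b' [c' [-> [hd' ht' hb' hc'] h1' h2']]]]]
   |M _ [d [t [b [c [-> [hd ht hb hc] h1 h2]]]]]].
(* [matA] and [matB] are reflections modulo 2; the scalars -1 and 1 are rotations. *)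
- exists 1, 0, 1, 0; split; [by congr mx2; ring | by split; eis_tac | by ring |].
  right; split; first exact: even_eis0.
  by rewrite subrr subr0; exact: even_eis0.
- exists 1, 0, 0, 1; split; [by congr mx2; ring | by split; eis_tac | by ring |].
  right; split; first exact: even_eis0.
  by rewrite subr0 subrr; exact: even_eis0.
- exists (-1), 0, 0, 0; split; [| by split; eis_tac | by ring |].
    by rewrite mx2_1 mx2_opp; congr mx2; ring.
  by left; split; rewrite subr0; exact: even_eis0.
- exists 1, 0, 0, 0; split; [| by split; eis_tac | by ring |].
    by rewrite mx2_1; congr mx2; ring.
  by left; split; rewrite subr0; exact: even_eis0.
- eexists _, _, _, _; split; [exact: gamma_mxM | by split; eis_tac | |
    exact: dihedral2M].
  transitivity (((d + pi_ * t) * d - b * (pi_ * c)) *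
                ((d' + pi_ * t') * d' - b' * (pi_ * c'))); first by ring.
  by rewrite h1 h1' mulr1.
(* The adjugate exchanges the diagonal entries, so t changes sign. *)
- exists (d + pi_ * t), (- t), (- b), (- c); split.
  + by rewrite mx2_inv //; congr mx2; ring.
  + by split; eis_tac.
  + by rewrite -[RHS]h1; ring.
  case: h2 => [] [h2 h3]; [left | right]; split.
  + by (suff -> : - t - - b = - (t - b) by even_tac); ring.
  + by (suff -> : - c - - b = - (c - b) by even_tac); ring.
  + by even_tac.
  + suff -> : d + pi_ * t - - b - - c = (d - b - c) + pi_ * t + (b + c) * 2
      by even_tac.
    by ring.
Qed.

(** * The span of 1, X, Y, XY and determinants of commutators *)

Lemma mx2_add a b c d a' b' c' d' :
  mx2 a b c d + mx2 a' b' c' d' = mx2 (a + a') (b + b') (c + c') (d + d').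
Proof.
apply/matrixP => i j; rewrite !mxE.
by case: (nat_of_ord i == 0%N); case: (nat_of_ord j == 0%N).
Qed.

Lemma mx2_scale k a b c d :
  k *: mx2 a b c d = mx2 (k * a) (k * b) (k * c) (k * d).
Proof.
apply/matrixP => i j; rewrite !mxE.
by case: (nat_of_ord i == 0%N); case: (nat_of_ord j == 0%N).
Qed.

Lemma mx2_scalar k : k%:M = mx2 k 0 0 k.
Proof. by rewrite -scalemx1 mx2_1 mx2_scale mulr1 mulr0. Qed.

Lemma mx2_det a b c d : \det (mx2 a b c d) = a * d - b * c.
Proof.
rewrite (expand_det_row _ 0) !big_ord_recl big_ord0 /cofactor !det_mx11 !mxE /=.
by rewrite addr0 expr0 expr1 mul1r mulN1r mulrN.
Qed.

Definition mx2E :=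
  (mx2_1, mx2_scalar, mx2_mul, mx2_scale, mx2_opp, mx2_add, mx2_tr, mx2_det).

Definition span_mx (X Y : 'M[algC]_2) p q r s : 'M[algC]_2 :=
  p%:M + q *: X + r *: Y + s *: (X *m Y).

Definition in_span (X Y M : 'M[algC]_2) : Prop :=
  exists p q r s, [/\ eis p, eis q, eis r & eis s] /\ M = span_mx X Y p q r s.

Lemma mx2_eta (M : 'M[algC]_2) : M = mx2 (M 0 0) (M 0 1) (M 1 0) (M 1 1).
Proof.
apply/matrixP => i j; rewrite !mxE.
by case: i j => [[|[|?]] hi] [[|[|?]] hj] //=; congr (M _ _); apply: val_inj.
Qed.

(** Cayley-Hamilton gives X^2 = x X - D, Y^2 = y Y - E and YX = (z - x y) + y X + x Y - XY, so the
    span is a ring over any ring containing the traces and determinants. *)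
Lemma span_mxM (X Y : 'M[algC]_2) p q r s p' q' r' s' :
  let x := \tr X in let y := \tr Y in let z := \tr (X *m Y) in
  let D := \det X in let E := \det Y in
  span_mx X Y p q r s *m span_mx X Y p' q' r' s' = span_mx X Y
    (p * p' - D * (q * q') - E * (r * r') + r * q' * (z - x * y)
      - x * E * (r * s') - y * D * (s * q') - D * E * (s * s'))
    (p * q' + q * p' + x * (q * q') + y * (r * q') + E * (r * s')
      + z * (s * q') - E * (s * r'))
    (p * r' + r * p' + y * (r * r') - D * (q * s') + x * (r * q')
      + z * (r * s') + D * (s * q'))
    (p * s' + s * p' + q * r' + x * (q * s') - r * q' + y * (s * r')
      + z * (s * s')).
Proof.
rewrite /span_mx (mx2_eta X) (mx2_eta Y).
move: (X 0 0) (X 0 1) (X 1 0) (X 1 1) (Y 0 0) (Y 0 1) (Y 1 0) (Y 1 1).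
by move=> a b c d e f g h; rewrite /= !mx2E; congr mx2; ring.
Qed.

(* [X, XY] = [X, Y] adj X and [Y, XY] = - [X, Y] Y. *)
Lemma span_mx_comm (X Y : 'M[algC]_2) p q r s p' q' r' s' :
  let P := span_mx X Y p q r s in let Q := span_mx X Y p' q' r' s' in
  P *m Q - Q *m P = (X *m Y - Y *m X) *m
    ((q * r' - r * q')%:M + (q * s' - s * q') *: ((\tr X)%:M - X)
      - (r * s' - s * r') *: Y).
Proof.
rewrite /span_mx (mx2_eta X) (mx2_eta Y).
move: (X 0 0) (X 0 1) (X 1 0) (X 1 1) (Y 0 0) (Y 0 1) (Y 1 0) (Y 1 1).
by move=> a b c d e f g h; rewrite /= !mx2E; congr mx2; ring.
Qed.

(** Fricke's identity with general determinants; for D = E = 1 and x = y it factors as - (z - 2) (z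
    + 2 - x^2). *)
Lemma det_comm (X Y : 'M[algC]_2) : let x := \tr X in let y := \tr Y in
  let z := \tr (X *m Y) in let D := \det X in let E := \det Y in
  \det (X *m Y - Y *m X) =
    4 * D * E - E * x ^+ 2 - D * y ^+ 2 - z ^+ 2 + x * y * z.
Proof.
rewrite (mx2_eta X) (mx2_eta Y).
move: (X 0 0) (X 0 1) (X 1 0) (X 1 1) (Y 0 0) (Y 0 1) (Y 1 0) (Y 1 1).
by move=> a b c d e f g h; rewrite /= !mx2E; ring.
Qed.

(** Modulo [pi_] both matrices are upper triangular with equal diagonal entries, so they commute
    there; every entry of the commutator is a multiple of [pi_]. *)
Lemma det_comm_gamma d t b c d' t' b' c' :
  let X := gamma_mx d t b c in let Y := gamma_mx d' t' b' c' in
  \det (X *m Y - Y *m X) = - pi_ ^+ 2 *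
    ((b * c' - b' * c) ^+ 2 + pi_ * (t * b' - t' * b) * (c * t' - c' * t)).
Proof. by rewrite /= !mx2E; ring. Qed.

(** * Integral matrices and the group inside the span *)

Definition eis_mx (M : 'M[algC]_2) : Prop := forall i j, eis (M i j).

Lemma eis_mxM M N : eis_mx M -> eis_mx N -> eis_mx (M *m N).
Proof.
move=> hM hN i j; rewrite !mxE !big_ord_recl big_ord0.
by eis_tac; first [exact: hM | exact: hN].
Qed.

Lemma eis_mxD M N : eis_mx M -> eis_mx N -> eis_mx (M + N).
Proof. by move=> hM hN i j; rewrite mxE; apply: eisD. Qed.

Lemma eis_mxN M : eis_mx M -> eis_mx (- M).
Proof. by move=> hM i j; rewrite mxE; apply: eisN. Qed.

Lemma eis_mxZ k M : eis k -> eis_mx M -> eis_mx (k *: M).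
Proof. by move=> hk hM i j; rewrite mxE; apply: eisM. Qed.

Lemma eis_mx_scalar k : eis k -> eis_mx k%:M.
Proof. by move=> hk i j; rewrite mxE; case: eqP => _ //; exact: (eis_nat 0). Qed.

Lemma eis_mx_tr M : eis_mx M -> eis (\tr M).
Proof. by move=> hM; rewrite (mx2_eta M) mx2_tr; apply: eisD; exact: hM. Qed.

Lemma eis_mx_det M : eis_mx M -> eis (\det M).
Proof. by move=> hM; rewrite (mx2_eta M) mx2_det; eis_tac; exact: hM. Qed.

Lemma eis_mx_gamma M : gamma_spec M -> eis_mx M /\ \det M = 1.
Proof.
move=> [d [t [b [c [-> [hd ht hb hc] h _]]]]]; split; last by rewrite mx2E.
by move=> i j; rewrite !mxE; do 2 case: ifP => _; eis_tac.
Qed.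

(** Products stay in the span by [span_mxM]. For inverses, determinant 1 gives M^-1 = tr M - M, and
    integrality of M makes tr M an admissible coefficient. *)
Lemma in_span_gen2 X Y : eis_mx X -> eis_mx Y ->
  (forall M, lift_gen2 X Y M -> eis_mx M /\ \det M = 1) ->
  forall M, lift_gen2 X Y M -> in_span X Y M.
Proof.
move=> eX eY h M.
have [ex ey] := (eis_mx_tr _ eX, eis_mx_tr _ eY).
have [eD eE] := (eis_mx_det _ eX, eis_mx_det _ eY).
have ez := eis_mx_tr _ (eis_mxM _ _ eX eY).
elim=> {M} [M [->|[->|->]]||M N _ [p [q [r [s [[hp hq hr hs] ->]]]]]
   _ [p' [q' [r' [s' [[hp' hq' hr' hs'] ->]]]]]
   |M gM [p [q [r [s [[hp hq hr hs] e]]]]]].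
- exists 0, 1, 0, 0; split; first by split; eis_tac.
  by rewrite /span_mx scale1r !scale0r raddf0 add0r !addr0.
- exists 0, 0, 1, 0; split; first by split; eis_tac.
  by rewrite /span_mx scale1r !scale0r raddf0 !add0r addr0.
- exists (-1), 0, 0, 0; split; first by split; eis_tac.
  by rewrite /span_mx !scale0r raddfN !addr0.
- exists 1, 0, 0, 0; split; first by split; eis_tac.
  by rewrite /span_mx !scale0r !addr0.
- rewrite span_mxM; eexists _, _, _, _; split; last reflexivity.
  by split; eis_tac.
have [eM dM] := h _ gM; have etM := eis_mx_tr _ eM.
exists (\tr M - p), (- q), (- r), (- s); split; first by split; eis_tac.
have -> : invmx M = (\tr M)%:M - M.
  move: dM; rewrite (mx2_eta M) mx2_det => dM.
  by rewrite mx2_inv // !mx2E; congr mx2; ring.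
rewrite {2}e /span_mx !scaleNr raddfB /= !opprD !addrA //.
Qed.

(** * Traces in Gamma and the conclusion *)

Lemma gamma_trace_neq0 M : gamma_spec M -> \tr M <> 0.
Proof.
move=> [d [t [b [c [-> [hd ht hb hc] h _]]]]]; rewrite mx2_tr => tr0.
have e : d + pi_ * t = - d by apply/eqP; rewrite -addr_eq0; apply/eqP.
rewrite e in h.
(* Trace 0 means 2 d = - pi_ t, so four times the determinant equation makes 4 a multiple of
   [pi_]. *)
apply: (pi_ndvd4 (- (pi_ * t ^+ 2 + 4 * (b * c)))); first by eis_tac.
transitivity (- (d + pi_ * t - d) ^+ 2 - 4 * (b * (pi_ * c))); first by ring.
transitivity (4 * (- d * d - b * (pi_ * c))); last by rewrite h mulr1.
by rewrite e; ring.
Qed.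

(** If X or Y is a reflection modulo 2, the common trace is even; two rotations commute modulo 2,
    which makes the cofactor v even. *)
Lemma det_comm_gamma_spec X Y : gamma_spec X -> gamma_spec Y -> \tr X = \tr Y ->
  exists v, [/\ eis v, \det (X *m Y - Y *m X) = - pi_ ^+ 2 * v
    & even_eis (\tr X) \/ even_eis v].
Proof.
move=> [d [t [b [c [-> [hd ht hb hc] _ hX]]]]].
move=> [d' [t' [b' [c' [-> [hd' ht' hb' hc'] _ hY]]]]] trXY.
rewrite det_comm_gamma; eexists; split; [|reflexivity|]; first by eis_tac.
have refl e s : eis e -> eis s -> even_eis s -> even_eis (e + pi_ * s + e).
  by move=> he hs hs2; rewrite (_ : _ + e = pi_ * s + e * 2); [even_tac | ring].
case: hX => [[htb hcb]|[ht2 _]]; last by left; rewrite mx2_tr; exact: refl.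
case: hY => [[htb' hcb']|[ht2' _]]; last by left; rewrite trXY mx2_tr; exact: refl.
right.
have -> : (b * c' - b' * c) ^+ 2 + pi_ * (t * b' - t' * b) * (c * t' - c' * t)
  = (b * c' - b' * c) * (b * (c' - b') - b' * (c - b))
    + pi_ * (c * t' - c' * t) * (b' * (t - b) - b * (t' - b')) by ring.
by even_tac.
Qed.

(* X, Y range over SL_2 lifts of elements of Gamma; "tr X = tr Y" is taken
   for these lifts (every choice of lifts is quantified over). *)
Theorem theorem1p3 (X Y : 'M[algC]_2) :
  GammaLift X -> GammaLift Y ->
  (forall M, lift_gen2 X Y M <-> GammaLift M) ->
  \tr X = \tr Y ->
  parabolic X /\ parabolic Y.
Proof.
move=> gX gY gen trXY.
have [sX sY] := (GammaLift_spec _ gX, GammaLift_spec _ gY).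
have [[eX dX] [eY dY]] := (eis_mx_gamma _ sX, eis_mx_gamma _ sY).
have span M : GammaLift M -> in_span X Y M.
  move/gen; apply: in_span_gen2 => // N /gen /GammaLift_spec; exact: eis_mx_gamma.
have [p [q [r [s [[hp hq hr hs] eA]]]]] := span matA (gen_in (or_introl erefl)).
have [p' [q' [r' [s' [[hp' hq' hr' hs'] eB]]]]] :=
  span matB (gen_in (or_intror (or_introl erefl))).
have ex := eis_mx_tr _ eX.
(* AB - BA = (XY - YX) W with W integral, so det (XY - YX) divides det (AB - BA) in Z[omega]. *)
have := span_mx_comm X Y p q r s p' q' r' s'; rewrite /= -eA -eB.
set W := (_ + _ - _) => /(congr1 determinant); rewrite det_mulmx => cAB.
have eW : eis (\det W).
  apply/eis_mx_det/eis_mxD; last by apply/eis_mxN/eis_mxZ; [eis_tac | exact: eY].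
  apply: eis_mxD; first by apply: eis_mx_scalar; eis_tac.
  apply: eis_mxZ; first by eis_tac.
  by apply: eis_mxD; [exact: eis_mx_scalar | exact: eis_mxN].
(* Non-commutation will exclude that X or Y is 1 or -1. *)
have cX : X *m Y <> Y *m X.
  move=> c; move: cAB; rewrite c subrr det0 mul0r /matA /matB !mx2E => /eqP.
  rewrite (_ : _ - _ = - pi_ ^+ 2); last by ring.
  by rewrite oppr_eq0 sqrf_eq0 (negbTE pi_neq0).
suff x4 : (\tr X) ^+ 2 = 4.
  split; split; [| split | | split]; rewrite -?trXY //; move=> e; apply: cX;
  by rewrite e ?mulNmx ?mulmxN ?mul1mx ?mulmx1.
have tr0 := gamma_trace_neq0 _ sX.
have [v [ev cXY par]] := det_comm_gamma_spec _ _ sX sY trXY.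
(* The two divisibilities meet: both sides carry the factor - pi_^2, and v is a unit. Hence v is not
   even and the trace is 2 y. *)
have vW : v * \det W = 1.
  apply: (mulfI (_ : - pi_ ^+ 2 != 0)); first by rewrite oppr_eq0 sqrf_eq0 pi_neq0.
  by rewrite mulrA -cXY -cAB /matA /matB !mx2E; ring.
case: par => [[y ey xy]|[k ek vk]]; last first.
  by case: (two_not_unit (k * \det W)); [eis_tac | rewrite mulrA -vk].
rewrite xy; apply: (trace_equation (\tr (X *m Y) - 2) _ v) => //.
- by have ez := eis_mx_tr _ (eis_mxM _ _ eX eY); eis_tac.
- exact: (eis_unit_norm _ _ ev eW).
(* Fricke's identity at equal traces, with a = tr XY - 2. *)
- apply: oppr_inj; rewrite -[RHS]mulNr -cXY det_comm dX dY -trXY -xy; ring.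
- by move=> y0; apply: tr0; rewrite xy y0 mulr0.
Qed.
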